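(* Let $A$ be an integral domain and let $\Delta\subseteq\mathrm{Spec}(A)$ be nonempty. Then $s_\Delta$ is a semistar operation of finite type if and only if $\Delta$ is compact (as a subspace of $\mathrm{Spec}(A)$ with the Zariski topology).
   Context: Let $A$ be an integral domain with quotient field $K$. $\overline{\mathbf F}(A)$ is the set of all nonzero $A$-submodules of $K$, and $\mathbf f(A)$ is the set of all nonzero finitely generated fractional ideals of $A$ (nonzero finitely generated $A$-submodules of $K$). A semistar operation on $A$ is a map $\star:\overline{\mathbf F}(A)\to\overline{\mathbf F}(A)$, $F\mapsto F^\star$, such that for all nonzero $k\in K$ and all $F,G\in\overline{\mathbf F}(A)$: $(kF)^\star=kF^\star$; $F\subseteq G$ implies $F^\star\subseteq G^\star$; $F\subseteq F^\star$; $(F^\star)^\star=F^\star$. A semistar operation $\star$ is of finite type if $F^\star=\bigcup\{G^\star:G\in\mathbf f(A),\,G\subseteq F\}$ for every $F\in\overline{\mathbf F}(A)$. For a nonempty set $\Delta$ of prime ideals of $A$, $s_\Delta$ is the semistar operation defined by $F^{s_\Delta}:=\bigcap\{FA_{\mathfrak p}:\mathfrak p\in\Delta\}$ for $F\in\overline{\mathbf F}(A)$. ''Compact'' means that every open cover has a finite subcover (no separation axiom). *)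

(* Defs.v *)
From HB Require Import structures.
From mathcomp Require Import all_boot all_algebra.
From mathcomp Require Import all_classical topology.

Set Implicit Arguments.
Unset Strict Implicit.
Unset Printing Implicit Defensive.

Import GRing.Theory.
Local Open Scope classical_set_scope.
Local Open Scope ring_scope.

(* [prime_idealr A] bundles boolean predicates on A; every subset of A is one
   by excluded middle, so no prime ideal is lost. *)
Definition Spec (A : idomainType) : Type := prime_idealr A.

Section Zariski.
Variable A : idomainType.

HB.instance Definition _ := gen_eqMixin (Spec A).
HB.instance Definition _ := gen_choiceMixin (Spec A).

Definition ideal_of (p : Spec A) : {pred A} := (p : prime_idealr A).

Definition zero_locus (E : set A) : set (Spec A) :=
  [set p | forall a, E a -> a \in ideal_of p].

Definition zariski_open (U : set (Spec A)) : Prop :=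
  exists E : set A, U = ~` zero_locus E.

Fact zariski_openT : zariski_open setT.
Proof.
exists setT; apply/seteqP; split=> // p _ /(_ 1 I).
by rewrite /ideal_of idealr1.
Qed.

Fact zariski_openI : setI_closed zariski_open.
Proof.
move=> _ _ [E ->] [E' ->].
exists [set c | exists a b, [/\ E a, E' b & c = a * b]].
rewrite -setCU; congr (~` _); apply/seteqP; split=> p /=.
  case=> hp _ [a [b [Ea E'b ->]]]; rewrite /ideal_of prime_idealrM.
    by have -> := hp _ Ea.
  by have -> := hp _ E'b; rewrite orbT.
move=> hp; have [hE|hE] := pselect (zero_locus E p); [by left|right=> b E'b].
have [a /not_implyP[Ea /negP pa]] := (existsNP _).2 hE.
have := hp (a * b); rewrite /ideal_of prime_idealrM => h.
have /orP[pa'|//] := h (ex_intro _ a (ex_intro _ b (And3 Ea E'b erefl))).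
by move: pa; rewrite /ideal_of pa'.
Qed.

Fact zariski_open_bigU (I : Type) (f : I -> set (Spec A)) :
  (forall i, zariski_open (f i)) -> zariski_open (\bigcup_i f i).
Proof.
move=> /choice[E fE]; exists (\bigcup_i E i); apply/seteqP; split=> p /=.
  by case=> i _; rewrite fE => hp; apply: contra_not hp => h a Ea;
    apply: h; exists i.
move=> /existsNP[a /not_implyP[[i _ Ea] pa]]; exists i => //.
by rewrite fE => h; apply: pa; apply: h.
Qed.

HB.instance Definition _ := isOpenTopological.Build (Spec A)
  zariski_openT zariski_openI zariski_open_bigU.

End Zariski.

Record Fbar (A : idomainType) := MkFbar {
  fbar_set :> set {fraction A};
  fbar0 : fbar_set 0;
  fbarD : forall x y, fbar_set x -> fbar_set y -> fbar_set (x + y);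
  fbarZ : forall (a : A) x, fbar_set x -> fbar_set (tofrac a * x);
  fbar_neq0 : exists2 x, fbar_set x & x != 0 }.

Lemma fbar_inj (A : idomainType) (F G : Fbar A) :
  F = G :> set {fraction A} -> F = G.
Proof.
case: F G => [F a b c d] [G a' b' c' d'] /= E; subst G.
by congr MkFbar; apply: Prop_irrelevance.
Qed.

Definition finitely_generated (A : idomainType) (F : Fbar A) : Prop :=
  exists (n : nat) (g : 'I_n -> {fraction A}),
    F = [set x | exists c : 'I_n -> A, x = \sum_(i < n) tofrac (c i) * g i]
      :> set {fraction A}.

Section Operations.
Variable A : idomainType.
Local Notation K := {fraction A}.
Implicit Types (F G : Fbar A) (p : Spec A).

Program Definition fscale (k : K) (hk : k != 0) F : Fbar A :=
  @MkFbar A [set k * x | x in F] _ _ _ _.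
Next Obligation. by move=> k hk F; exists 0; [exact: fbar0|rewrite mulr0]. Qed.
Next Obligation.
move=> k hk F _ _ [x Fx <-] [y Fy <-].
by exists (x + y); [exact: fbarD|rewrite mulrDr].
Qed.
Next Obligation.
move=> k hk F a _ [x Fx <-].
by exists (tofrac a * x); [exact: fbarZ|rewrite mulrCA].
Qed.
Next Obligation.
move=> k hk F; have [x Fx x0] := fbar_neq0 F.
by exists (k * x); [exists x|rewrite mulf_neq0].
Qed.

Program Definition fmul F G : Fbar A :=
  @MkFbar A [set z | exists n (x y : 'I_n -> K),
    [/\ forall i, fbar_set F (x i), forall i, fbar_set G (y i) & z = \sum_(i < n) x i * y i]]
    _ _ _ _.
Next Obligation.
move=> F G; exists 0%N, (fun=> 0), (fun=> 0).
by split; [case|case|rewrite big_ord0].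
Qed.
Next Obligation.
move=> F G _ _ [n [x [y [Fx Gy ->]]]] [m [x' [y' [Fx' Gy' ->]]]].
pose cat (u : 'I_n -> K) (v : 'I_m -> K) (i : 'I_(n + m)) :=
  match fintype.split i with inl j => u j | inr j => v j end.
exists (n + m)%N, (cat x x'), (cat y y'); split.
- by move=> i; rewrite /cat; case: fintype.split.
- by move=> i; rewrite /cat; case: fintype.split.
- rewrite big_split_ord /=; congr (_ + _); apply: eq_bigr => i _; rewrite /cat.
    by rewrite (unsplitK (inl i)).
  by rewrite (unsplitK (inr i)).
Qed.
Next Obligation.
move=> F G a _ [n [x [y [Fx Gy ->]]]].
exists n, (fun i => tofrac a * x i), y; split=> // [i|]; first exact: fbarZ.
by rewrite mulr_sumr; apply: eq_bigr => i _; rewrite mulrA.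
Qed.
Next Obligation.
move=> F G; have [x Fx x0] := fbar_neq0 F; have [y Gy y0] := fbar_neq0 G.
exists (x * y); last by rewrite mulf_neq0.
by exists 1%N, (fun=> x), (fun=> y); split=> //; rewrite big_ord1.
Qed.

Program Definition localization p : Fbar A :=
  @MkFbar A [set x | exists a s : A,
    s \notin ideal_of p /\ x = tofrac a / tofrac s] _ _ _ _.
Next Obligation.
move=> p; exists 0, 1; rewrite rmorph0 mul0r; split=> //.
by rewrite /ideal_of idealr1.
Qed.
Next Obligation.
move=> p _ _ [a [s [ps ->]]] [b [t [pt ->]]].
exists (a * t + b * s), (s * t); split.
  by rewrite /ideal_of prime_idealrM negb_or ps.
have nz u : u \notin ideal_of p -> tofrac u != 0.
  rewrite tofrac_eq0; apply: contraNneq => ->; exact: idealr0.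
by rewrite addf_div ?nz // rmorphD !rmorphM.
Qed.
Next Obligation.
move=> p c _ [a [s [ps ->]]]; exists (c * a), s; split=> //.
by rewrite rmorphM mulrA.
Qed.
Next Obligation.
move=> p; exists 1; last exact: oner_neq0.
exists 1, 1; rewrite rmorph1 divr1; split=> //.
by rewrite /ideal_of idealr1.
Qed.

Lemma sub_fmul_localization F p : F `<=` fmul F (localization p).
Proof.
move=> x Fx; exists 1%N, (fun=> x), (fun=> 1); split=> // [_|].
  by exists 1, 1; rewrite rmorph1 divr1 /ideal_of idealr1.
by rewrite big_ord1 mulr1.
Qed.

Program Definition s_ (Delta : set (Spec A)) F : Fbar A :=
  @MkFbar A (\bigcap_(p in Delta) fmul F (localization p)) _ _ _ _.
Next Obligation. by move=> Delta F p _; apply: fbar0. Qed.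
Next Obligation.
by move=> Delta F x y hx hy p Dp; apply: fbarD; [exact: hx|exact: hy].
Qed.
Next Obligation. by move=> Delta F a x hx p Dp; apply: fbarZ; exact: hx. Qed.
Next Obligation.
move=> Delta F; have [x Fx x0] := fbar_neq0 F.
by exists x => // p _; apply: sub_fmul_localization.
Qed.

End Operations.

Record semistar_operation (A : idomainType) (star : Fbar A -> Fbar A) : Prop := {
  semistarZ : forall (k : {fraction A}) (hk : k != 0) (F : Fbar A),
    star (fscale hk F) = fscale hk (star F);
  semistar_mono : forall F G : Fbar A, F `<=` G -> star F `<=` star G;
  semistar_ext : forall F : Fbar A, F `<=` star F;
  semistar_idem : forall F : Fbar A, star (star F) = star F }.

Definition finite_type (A : idomainType) (star : Fbar A -> Fbar A) : Prop :=
  forall F : Fbar A,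
    star F = \bigcup_(G in [set G : Fbar A | finitely_generated G /\ G `<=` F])
               star G :> set {fraction A}.

(* Main.v *)
Require Import Defs.
From mathcomp Require Import all_boot all_algebra finmap.
From mathcomp Require Import all_classical topology.

(** The whole argument rests on one description of localized modules: an
    element [x] of the quotient field lies in [F A_p] iff some denominator
    [s] outside [p] brings it into [F], i.e. iff the conductor ideal
    [(F : x) = { s | s x \in F }] is not contained in [p]
    ([fmul_localizationP]).  Hence [x] lies in [s_Delta F] iff the basic open
    sets [D(s)], for [s] in [(F : x)], cover [Delta] ([s_P]), and finiteness
    of the operation and finiteness of covers become the same thing.

    That [s_Delta] is a semistar operation holds for every [Delta]
    ([s_semistar]): two successive denominators outside a prime multiply to
    one outside that prime, which is idempotence.

    If [Delta] is compact and [x] lies in [s_Delta F], finitely many [D(c)]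
    with [c x \in F] already cover [Delta]; then the finitely many elements
    [c x] generate a submodule [G] of [F] with [x] in [s_Delta G]
    ([compact_finite_type]).

    Conversely, given an open cover of [Delta] by sets [f i], let [F] be the
    set of the [a] in [A] vanishing off some finite union of the [f i], that
    is, lying in every prime outside that union.  This is an ideal, because
    finite unions are directed, and [1] lies in [s_Delta F] because the [f i]
    cover [Delta].  By finite type, [1] lies in [s_Delta G] for some finitely
    generated [G] inside [F].  A single finite union of the [f i] serves all
    generators, hence all elements, of [G]; a prime of [Delta] outside this
    union would contain [G] and so could not have [1] in [G A_p].  Thus this
    finite union covers [Delta] ([finite_type_compact]). *)

Set Implicit Arguments.
Unset Strict Implicit.
Unset Printing Implicit Defensive.

Import GRing.Theory.
Local Open Scope classical_set_scope.
Local Open Scope ring_scope.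

(** * Localization and the semistar axioms *)

Section Localization.
Variable A : idomainType.
Local Notation K := {fraction A}.
Implicit Types (F G : Fbar A) (p : Spec A) (Delta : set (Spec A)).

Lemma notin_tofrac_neq0 p s : s \notin ideal_of p -> tofrac s != 0 :> K.
Proof. by rewrite tofrac_eq0; apply: contraNneq => ->; exact: idealr0. Qed.

Lemma fbar_sum F n (x : 'I_n -> K) :
  (forall i, fbar_set F (x i)) -> fbar_set F (\sum_(i < n) x i).
Proof.
move=> Fx; apply: (@big_ind _ (fbar_set F)) => //; first exact: fbar0.
exact: fbarD.
Qed.

(** The right-hand side is closed under sums, two denominators being replaced
    by their product, so only the products [y * (a / s)] with [y] in [F] need
    to be examined, and these have denominator [s]. *)
Lemma fmul_localizationP F p (x : K) :
  fbar_set (fmul F (localization p)) x <->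
  exists2 s : A, s \notin ideal_of p & fbar_set F (tofrac s * x).
Proof.
split=> [[n [y [z [Fy Az ->]]]]|[s ps Fsx]]; last first.
  exists 1%N, (fun=> tofrac s * x), (fun=> (tofrac s)^-1).
  split=> // [_|]; first by exists 1, s; rewrite rmorph1 mul1r.
  by rewrite big_ord1 mulrAC divff ?mul1r // (notin_tofrac_neq0 ps).
pose P (u : K) := exists2 s : A, s \notin ideal_of p & fbar_set F (tofrac s * u).
apply: (@big_ind _ P).
- by exists 1; [rewrite /ideal_of idealr1|rewrite mulr0; exact: fbar0].
- move=> u v [s ps Fsu] [t pt Ftv]; exists (s * t).
    by rewrite /ideal_of prime_idealrM negb_or ps.
  rewrite rmorphM mulrDr; apply: fbarD; last by rewrite -mulrA; exact: fbarZ.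
  by rewrite mulrAC mulrC; exact: fbarZ.
- move=> i _; have [a [s [ps ->]]] := Az i; exists s => //.
  have -> : tofrac s * (y i * (tofrac a / tofrac s)) = tofrac a * y i.
    rewrite mulrCA [tofrac s * _]mulrC divfK ?(notin_tofrac_neq0 ps) //.
    exact: mulrC.
  exact: fbarZ.
Qed.

Lemma s_P Delta F (x : K) :
  fbar_set (s_ Delta F) x <->
  forall p, Delta p -> exists2 s : A, s \notin ideal_of p & fbar_set F (tofrac s * x).
Proof. by split=> h p Dp; apply/fmul_localizationP; exact: h. Qed.

Lemma s_mono Delta F G : F `<=` G -> s_ Delta F `<=` s_ Delta G.
Proof.
move=> FG x /s_P Fx; apply/s_P => p /Fx[s ps Fsx].
by exists s => //; exact: FG.
Qed.

Lemma s_ext Delta F : F `<=` s_ Delta F.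
Proof. by move=> x Fx p _; exact: sub_fmul_localization. Qed.

(** Homogeneity is read off the conductors, as [(kF : kx) = (F : x)].  For
    idempotence, let [s] bring [x] into [s_ Delta F] and then [t] bring [s x]
    into [F], both outside [p]; then [t s] is outside [p] as [p] is prime. *)
Lemma s_semistar Delta : semistar_operation (s_ Delta).
Proof.
split=> [k k0 F|F G|F|F]; [|exact: s_mono|exact: s_ext|].
- apply: fbar_inj; apply/seteqP; split=> [x /s_P Fx|_ [x /s_P Fx <-]].
    exists (k^-1 * x); last by rewrite mulVKf.
    apply/s_P => p /Fx[s ps [y Fy kysx]]; exists s => //.
    by rewrite mulrCA -kysx mulKf.
  apply/s_P => p /Fx[s ps Fsx]; exists s => //.
  by exists (tofrac s * x) => //; rewrite mulrCA.
- apply: fbar_inj; apply/seteqP; split; last exact: s_ext.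
  move=> x /s_P Fx; apply/s_P => p Dp; have [s ps /s_P Fsx] := Fx p Dp.
  have [t pt Ftsx] := Fsx p Dp; exists (t * s).
    by rewrite /ideal_of prime_idealrM negb_or pt.
  by rewrite rmorphM -mulrA.
Qed.

End Localization.

(** * Finitely generated submodules *)

Section Span.
Variable A : idomainType.
Local Notation K := {fraction A}.

Definition lincombs n (g : 'I_n -> K) : set K :=
  [set x | exists c : 'I_n -> A, x = \sum_(i < n) tofrac (c i) * g i].

Lemma lincombs_gen n (g : 'I_n -> K) i : lincombs g (g i).
Proof.
exists (fun j => (j == i)%:R); rewrite (bigD1 i) //= eqxx rmorph1 mul1r.
by rewrite big1 ?addr0 // => j /negPf->; rewrite rmorph0 mul0r.
Qed.

Lemma lincombs_sub n (g : 'I_n -> K) (F : Fbar A) :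
  (forall i, fbar_set F (g i)) -> lincombs g `<=` F.
Proof. by move=> Fg _ [c ->]; apply: fbar_sum => i; exact: fbarZ. Qed.

Program Definition fspan n (g : 'I_n -> K) (g0 : exists i, g i != 0) :=
  @MkFbar A (lincombs g) _ _ _ _.
Next Obligation.
by move=> n g _; exists (fun=> 0); rewrite big1 // => i _; rewrite rmorph0 mul0r.
Qed.
Next Obligation.
move=> n g _ _ _ [c ->] [d ->]; exists (fun i => c i + d i).
by rewrite -big_split /=; apply: eq_bigr => i _; rewrite rmorphD mulrDl.
Qed.
Next Obligation.
move=> n g _ a _ [c ->]; exists (fun i => a * c i).
by rewrite mulr_sumr; apply: eq_bigr => i _; rewrite rmorphM mulrA.
Qed.
Next Obligation.
by move=> n g [i gi0]; exists (g i) => //; exact: lincombs_gen.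
Qed.

Lemma fg_fspan n (g : 'I_n -> K) (g0 : exists i, g i != 0) :
  finitely_generated (fspan g0).
Proof. by exists n, g. Qed.

(** The nonzero element that every module contains joins the generators, so
    that the span is again a nonzero module even when all of [r] vanishes. *)
Lemma fg_submodule_containing (F : Fbar A) (r : seq K) :
  (forall y, y \in r -> fbar_set F y) ->
  exists G : Fbar A,
    [/\ finitely_generated G, G `<=` F & forall y, y \in r -> fbar_set G y].
Proof.
move=> Fr; have [x0 Fx0 x0_neq0] := fbar_neq0 F.
pose g (i : 'I_(size (x0 :: r))) : K := (x0 :: r)`_i.
have g0 : exists i, g i != 0 by exists ord0.
exists (fspan g0); split; first exact: fg_fspan.
  apply: lincombs_sub => i; have := mem_nth 0 (ltn_ord i).
  by rewrite inE -/(g i) => /orP[/eqP->//|]; exact: Fr.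
move=> y ry; have lt_y : (index y (x0 :: r) < size (x0 :: r))%N.
  by rewrite index_mem inE ry orbT.
have -> : y = g (Ordinal lt_y) by rewrite /g nth_index // inE ry orbT.
exact: lincombs_gen.
Qed.

End Span.

(** * Compactness and finite type *)

Section FiniteType.
Variable A : idomainType.
Local Notation K := {fraction A}.
Implicit Types (F G : Fbar A) (p : Spec A) (Delta : set (Spec A)).

Lemma open_D (c : A) : open [set p : Spec A | c \notin ideal_of p].
Proof.
exists [set c]; apply/seteqP; split=> p /=; first by move=> /negP + h; apply; exact: h.
by move=> h; apply/negP => pc; apply: h => _ ->.
Qed.

(** The cover to refine is indexed by the conductor [(F : x)] itself; the
    submodule is generated by the [c x] for [c] in a finite subcover, so each
    such [c] is a denominator bringing [x] into it. *)
Lemma compact_finite_type Delta : cover_compact Delta -> finite_type (s_ Delta).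
Proof.
move=> cD F; apply/seteqP; split=> [x /s_P Fx|x [G [_ GF]]]; last exact: s_mono.
pose f (c : A) := [set p : Spec A | c \notin ideal_of p].
have [|p /Fx[s ps Fsx]|C CF Ccov] := cD A [set c | fbar_set F (tofrac c * x)] f.
- by move=> c _; exact: open_D.
- by exists s.
have [|G [fgG GF Gr]] :=
    @fg_submodule_containing _ F [seq tofrac c * x | c <- C].
  by move=> _ /mapP[c Cc ->]; have := CF c Cc; rewrite inE.
exists G => //; apply/s_P => p /Ccov[c Cc pc]; exists c => //.
by apply: Gr; exact: map_f.
Qed.

Section Vanishing.
Variables (I : choiceType) (f : I -> set (Spec A)).

Definition vanish_off (C : {fset I}) : set A :=
  [set a | forall p, (forall i, i \in C -> ~ f i p) -> a \in ideal_of p].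

Lemma vanish_off_subset (C C' : {fset I}) :
  (C `<=` C')%fset -> vanish_off C `<=` vanish_off C'.
Proof. by move=> /fsubsetP CC' a h p hp; apply: h => i /CC'; exact: hp. Qed.

Lemma vanish_offD C a b : vanish_off C a -> vanish_off C b -> vanish_off C (a + b).
Proof. by move=> ha hb p hp; rewrite /ideal_of rpredD ?ha ?hb. Qed.

Lemma vanish_offM C a b : vanish_off C b -> vanish_off C (a * b).
Proof. by move=> hb p hp; rewrite /ideal_of idealMr ?hb. Qed.

Lemma vanish_off_sum C n (a : 'I_n -> A) :
  (forall i, vanish_off C (a i)) -> vanish_off C (\sum_(i < n) a i).
Proof. by move=> ha p hp; rewrite /ideal_of rpred_sum // => i _; exact: ha. Qed.

(** The ideals of the complements of the [f i] are rich enough to test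
    membership: [f i] is the complement of the zero locus of some [E], and any
    [a] in [E] outside [p] does. *)
Lemma open_separate i p : open (f i) -> f i p ->
  exists2 a, vanish_off [fset i]%fset a & a \notin ideal_of p.
Proof.
case=> E fE; rewrite fE => /existsNP[a /not_implyP[Ea /negP pa]].
exists a => // q hq; have := hq i (fset11 i); rewrite fE.
by move=> /contrapT; apply.
Qed.

Variables (D : set I) (Delta : set (Spec A)).
Hypotheses (Delta_nonempty : nonempty Delta)
  (f_open : forall i, D i -> open (f i)) (f_cover : Delta `<=` cover D f).

(** A directed union of radical ideals, standing in for the ideal generated by
    equations of all the closed sets [~` f i].  Each element carries a finite
    union of the [f i], from which the finite subcover is eventually built, so
    no expansion into generators has to be tracked. *)
Program Definition vanish_ideal : Fbar A :=
  @MkFbar A [set x : K | exists C : {fset I}, exists2 a,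
    {subset C <= D} /\ vanish_off C a & x = tofrac a] _ _ _ _.
Next Obligation.
exists fset0, 0; last by rewrite rmorph0.
by split=> // p _; exact: idealr0.
Qed.
Next Obligation.
move=> _ _ [C [a [CD Ca] ->]] [C' [b [C'D Cb] ->]].
exists (C `|` C')%fset, (a + b); last by rewrite rmorphD.
split; first by move=> i; rewrite inE => /orP[/CD|/C'D].
apply: vanish_offD; first exact: vanish_off_subset (fsubsetUl _ _) _ Ca.
exact: vanish_off_subset (fsubsetUr _ _) _ Cb.
Qed.
Next Obligation.
move=> c _ [C [a [CD Ca] ->]]; exists C, (c * a); last by rewrite rmorphM.
by split=> //; exact: vanish_offM.
Qed.
Next Obligation.
have [p Dp] := Delta_nonempty; have [i Di fip] := f_cover Dp.
have [a ia pa] := open_separate (f_open Di) fip.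
exists (tofrac a); last exact: notin_tofrac_neq0 pa.
exists [fset i]%fset, a => //; split=> // j.
by rewrite !inE => /eqP->.
Qed.

Lemma s_vanish_ideal1 : fbar_set (s_ Delta vanish_ideal) 1.
Proof.
apply/s_P => p Dp; have [i Di fip] := f_cover Dp.
have [a ia pa] := open_separate (f_open Di) fip.
exists a => //; rewrite mulr1; exists [fset i]%fset, a => //; split=> // j.
by rewrite !inE => /eqP->.
Qed.

(** Finitely many generators need only one common finite union, because
    vanishing off a set is inherited by larger unions. *)
Lemma fg_vanish_ideal G : finitely_generated G -> G `<=` vanish_ideal ->
  exists2 C : {fset I}, {subset C <= D} &
    forall x, fbar_set G x -> exists2 a, vanish_off C a & x = tofrac a.
Proof.
case=> n [g Gg] GF.
have /choice[C /choice[a gE]] : forall i, exists C : {fset I}, exists a,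
    [/\ {subset C <= D}, vanish_off C a & g i = tofrac a].
  move=> i; have : fbar_set G (g i) by rewrite Gg; exact: lincombs_gen.
  by move=> /GF[C [a [CD Ca] gia]]; exists C, a.
exists (\bigcup_(i <- enum 'I_n) C i)%fset.
  by move=> j /bigfcupP[i _]; have [CD _ _] := gE i; exact: CD.
rewrite Gg => _ [c ->]; exists (\sum_(i < n) c i * a i).
  apply: vanish_off_sum => i; apply: vanish_offM; have [_ Ca _] := gE i.
  by apply: vanish_off_subset Ca; apply: bigfcup_sup; rewrite ?mem_enum.
rewrite rmorph_sum; apply: eq_bigr => i _.
by have [_ _ ->] := gE i; rewrite rmorphM.
Qed.

End Vanishing.

(** A prime of [Delta] missed by the finite union [C] attached to [G] contains
    every element of [G]; yet [1] in [s_ Delta G] provides an element of [G]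
    outside that prime. *)
Lemma finite_type_compact Delta :
  nonempty Delta -> finite_type (s_ Delta) -> cover_compact Delta.
Proof.
move=> D0 ft I D f fop fcov.
have := s_vanish_ideal1 D0 fop fcov; rewrite ft => -[G [fgG GF] /s_P G1].
have [C CD CG] := fg_vanish_ideal fgG GF; exists C => // p Dp.
have [s ps] := G1 p Dp; rewrite mulr1 => /CG[a Ca /eqP]; rewrite tofrac_eq => /eqP sa.
apply: contrapT => Cp; move/negP: ps; apply; rewrite sa; apply: Ca => i Ci fip.
by apply: Cp; exists i.
Qed.

End FiniteType.

Theorem corollary4p4 (A : idomainType) (Delta : set (Spec A))
    (Delta_nonempty : nonempty Delta) :
  (semistar_operation (s_ Delta) /\ finite_type (s_ Delta)) <->
  cover_compact Delta.
Proof.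
split=> [[_]|cD]; first exact: finite_type_compact.
by split; [exact: s_semistar|exact: compact_finite_type].
Qed.
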